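(* Let $m\ge5$ and $\omega\in\Omega$. Then $\mathbb A^{\delta_\omega}(G_2(m))$ is an axial algebra with axis set $\{c_b^{\delta_\omega}:b\in\mathcal B,\ \omega\in\operatorname{supp}(b)\}$. The Peirce spectrum of each axis is $$\operatorname{Spec}L(c_b^{\delta_\omega})=\bigl\{1,\ (-1)^{m-3},\ (\tfrac12)^{2(m-3)},\ (-\tfrac12)^{2},\ 0^{\binom{m-3}{2}}\bigr\},$$ and the fusion law, the same at every axis and independent of $m$, is the symmetric rule $\mathscr F$ on $\{1,-\tfrac12,0,-1,\tfrac12\}$ given by $$\begin{array}{c|ccccc} & 1 & -\tfrac12 & 0 & -1 & \tfrac12\\ \hline 1 & \{1\} & \{-\tfrac12\} & \varnothing & \{-1\} & \{\tfrac12\}\\ -\tfrac12 & \{-\tfrac12\} & \{1,-\tfrac12\} & \varnothing & \{\tfrac12\} & \{-1,\tfrac12\}\\ 0 & \varnothing & \varnothing & \{0\} & \{-1,\tfrac12\} & \{-1,\tfrac12\}\\ -1 & \{-1\} & \{\tfrac12\} & \{-1,\tfrac12\} & \{1,0\} & \{-\tfrac12,0\}\\ \tfrac12 & \{\tfrac12\} & \{-1,\tfrac12\} & \{-1,\tfrac12\} & \{-\tfrac12,0\} & \{1,-\tfrac12,0\} \end{array}$$ that is, for each such axis $c$, with $A_\lambda=\ker(L(c)-\lambda\operatorname{Id})$, one has $A_\lambda\circ_{\delta_\omega} A_\mu\subseteq\bigoplus_{\nu\in\mathscr F(\lambda,\mu)}A_\nu$ for all $\lambda,\mu$. (For $m=5$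 one has in addition $A_0\circ_{\delta_\omega}A_0=0$.)
   Context: Let $K$ be a field of characteristic $0$ and $\Omega=\{1,\dots,m\}$. The Grassmannian geometry $G_2(m)$ has point set $\mathcal P=\binom{\Omega}{2}$ (the point $\{i,j\}$ is written $ij$) and block set $\mathcal B$ consisting of the triples $b_{ijk}=\{ij,ik,jk\}$, one for each $3$-subset $\{i,j,k\}\subseteq\Omega$; $\operatorname{supp}(b_{ijk})=\{i,j,k\}$. For a decoration $\delta:\mathcal B\to\{\pm1\}$, $\mathbb A^\delta(G_2(m))$ is the commutative (nonassociative) $K$-algebra with basis $\{e_p:p\in\mathcal P\}$ and bilinear product $e_{ij}\circ_\delta e_{ik}=\delta(b_{ijk})e_{jk}$ for distinct $i,j,k\in\Omega$, and $e_p\circ_\delta e_q=0$ if $p=q$ or $p\cap q=\varnothing$. The block idempotent of $b$ is $c_b^\delta=\tfrac12\delta(b)\sum_{p\in b}e_p$ and $L(c):x\mapsto c\circ_\delta x$. The star decoration at $\omega$ is $\delta_\omega(b)=-1$ if $\omega\in\operatorname{supp}(b)$, and $\delta_\omega(b)=1$ otherwise. $\operatorname{Spec}$ is the multiset of eigenvalues with algebraic multiplicity; exponents denote multiplicities. An axial algebra is a commutative nonassociative algebra generated (as an algebra) by a set of idempotents, its axes, such that for each axis $a$ the operator $L(a)$ is semisimple (diagonalizable) with eigenvalues in a fixed finite set $\Lambda$, and the eigenspaces $A_\lambda=\ker(L(a)-\lambda\operatorname{Id})$ satisfy $A_\lambda A_\mu\subseteq\bigoplus_{\nu\in\mathscr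 F(\lambda,\mu)}A_\nu$ for a fixed rule (fusion law) $\mathscr F:\Lambda\times\Lambda\to 2^\Lambda$ valid at every axis (an empty sum is $0$). Here $\Lambda=\{1,-1,\tfrac12,-\tfrac12,0\}$. *)

(* Defs.v *)
From HB Require Import structures.
From mathcomp Require Import all_boot all_order all_algebra.

Set Implicit Arguments.
Unset Strict Implicit.
Unset Printing Implicit Defensive.

Import GRing.Theory passmx.
Local Open Scope ring_scope.

Section AxialAlgebras.

Variables (K : fieldType) (V : vectType K).

(* Matrix of an endomorphism in a fixed basis of V; the characteristic
   polynomial and diagonalizability do not depend on that basis. *)
Definition endmx (f : 'End(V)) : 'M[K]_(\dim {:V}) :=
  mxof (vbasis {:V}) (vbasis {:V}) f.

(* Spec f is the multiset listed by s (eigenvalues with algebraic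
   multiplicity). *)
Definition Spec_is (f : 'End(V)) (s : seq K) : Prop :=
  char_poly (endmx f) = \prod_(a <- s) ('X - a%:P).

Variable mul : {bilinear V -> V -> V}.

Definition Lmul (c : V) : 'End(V) := linfun (mul c).

(* The smallest subalgebra containing X is V. *)
Definition generated_by (X : {pred V}) : Prop :=
  forall U : {vspace V}, {subset X <= U} ->
    (forall x y, x \in U -> y \in U -> mul x y \in U) -> U = {:V}%VS.

(* Lambda lists the finite set of allowed eigenvalues and F the fusion law.
   Eigenspaces of distinct eigenvalues are independent, so the sum over
   F l k of the eigenspaces is automatically direct. *)
Record is_axial_algebra (X : {pred V}) (Lambda : seq K)
    (F : K -> K -> seq K) : Prop := IsAxialAlgebra {
  axial_mulC : commutative mul;
  axial_idem : forall c, c \in X -> mul c c = c;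
  axial_gen : generated_by X;
  axial_diag : forall c, c \in X -> diagonalizable (endmx (Lmul c));
  axial_eigen : forall c, c \in X ->
    forall l, leigenvalue (Lmul c) l -> l \in Lambda;
  axial_fusion_sub : forall l k, l \in Lambda -> k \in Lambda ->
    {subset F l k <= Lambda};
  axial_fusion : forall c, c \in X ->
    forall l k, l \in Lambda -> k \in Lambda ->
    forall x y, x \in leigenspace (Lmul c) l -> y \in leigenspace (Lmul c) k ->
    mul x y \in (\sum_(n <- F l k) leigenspace (Lmul c) n)%VS
}.

End AxialAlgebras.

(* The algebra of a decorated geometry with point set P and block set B, where
   the points of a block b form the 3-subset pts b of P. Signs are encoded by
   booleans: delta b = true stands for -1. *)
Section DecoratedAlgebra.

Variables (K : fieldType) (P B : finType).

Definition galg := {ffun P -> K^o}.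

HB.instance Definition _ := Vector.on galg.

Definition evec (p : P) : galg := [ffun q => (q == p)%:R].

Variables (pts : B -> {set P}) (delta : B -> bool).

Definition sgn (b : B) : K := (-1) ^+ delta b.

(* Product of two basis vectors: sgn b *: evec r if p, q and r are the three
   points of a block b, and 0 if p = q or no block contains p and q; see
   G2mul_evec, G2mul_evec_same and G2mul_evec_disjoint for the Grassmannian
   geometry. *)
Definition gmul_basis (p q : P) : galg :=
  \sum_(b : B) \sum_(r : P |
      [&& p \in pts b, q \in pts b, r \in pts b & uniq [:: p; q; r]])
    sgn b *: evec r.

Definition gmul (x y : galg) : galg :=
  \sum_(p : P) \sum_(q : P) (x p * y q) *: gmul_basis p q.

Lemma gmul_bilinear : bilinear_for *:%R *:%R gmul.
Proof.
split=> [y a x x'|x a y y'] /=; rewrite /gmul scaler_sumr -big_split /=;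
  apply: eq_bigr => p _; rewrite scaler_sumr -big_split /=;
  apply: eq_bigr => q _; rewrite !ffunE scalerA -scalerDl; congr (_ *: _).
- by rewrite mulrDl mulrA.
- by rewrite mulrDr mulrCA.
Qed.

HB.instance Definition _ :=
  bilinear_isBilinear.Build K galg galg galg *:%R *:%R gmul gmul_bilinear.

Definition block_idem (b : B) : galg :=
  (2^-1 * sgn b) *: \sum_(p in pts b) evec p.

Lemma gmul_evec p q : gmul (evec p) (evec q) = gmul_basis p q.
Proof.
have evecE u v : evec u v = (v == u)%:R by rewrite ffunE.
rewrite /gmul (bigD1 p) //= [X in X + _](bigD1 q) //= !evecE !eqxx.
rewrite mulr1 scale1r [X in _ + X + _]big1; last first.
  by move=> q' /negPf nq; rewrite !evecE nq mulr0 scale0r.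
rewrite addr0 [X in _ + X]big1 ?addr0 // => p' /negPf np.
by rewrite big1 // => q' _; rewrite !evecE np mul0r scale0r.
Qed.

Lemma gmul_basis_block p q r b :
    (forall b', p \in pts b' -> q \in pts b' -> b' = b) ->
    pts b = [set p; q; r] -> uniq [:: p; q; r] ->
  gmul_basis p q = sgn b *: evec r.
Proof.
move=> bE Eb; rewrite /= !inE negb_or andbT => /andP[/andP[npq npr] nqr].
have [pb qb] : p \in pts b /\ q \in pts b by rewrite Eb !inE !eqxx orbT.
rewrite /gmul_basis (bigD1 b) //= [X in _ + X]big1 => [|b' nb]; last first.
  rewrite big1 // => r' /and4P[pb' qb' _ _].
  by rewrite (bE b' pb' qb') eqxx in nb.
rewrite addr0 (big_pred1 r) // => r'.
rewrite pb qb Eb !inE negb_or npq andbT /=.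
have [->|nr] := eqVneq r' r; first by rewrite orbT npr nqr.
rewrite orbF [p == r']eq_sym [q == r']eq_sym.
by case: (r' == p); case: (r' == q).
Qed.

Lemma gmul_basis0 p q :
  (forall b, p \in pts b -> q \in pts b -> p = q) -> gmul_basis p q = 0.
Proof.
move=> bE; rewrite /gmul_basis big1 // => b _; rewrite big1 // => r.
by case/and4P=> /bE pq /pq->; rewrite /= inE eqxx.
Qed.

End DecoratedAlgebra.

Section Grassmannian.

Variable m : nat.

Definition point := {p : {set 'I_m} | #|p| == 2%N}.

(* A block {ij, ik, jk} is represented by its support {i, j, k}. *)
Definition block := {b : {set 'I_m} | #|b| == 3%N}.

Definition supp (b : block) : {set 'I_m} := val b.

Definition points_of (b : block) : {set point} :=
  [set p : point | val p \subset supp b].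

Definition star_decoration (omega : 'I_m) (b : block) : bool :=
  omega \in supp b.

Variables (K : fieldType) (delta : block -> bool).

Definition G2mul : {bilinear galg K point -> galg K point -> galg K point} :=
  gmul points_of delta.

Definition G2idem (b : block) : galg K point := block_idem K points_of delta b.

Lemma points_ofE (i j k : 'I_m) (p q r : point) (b : block) :
    uniq [:: i; j; k] ->
    val p = [set i; j] -> val q = [set i; k] -> val r = [set j; k] ->
    supp b = [set i; j; k] ->
  points_of b = [set p; q; r].
Proof.
rewrite /= !inE negb_or andbT => /andP[/andP[nij nik] njk] Ep Eq Er Eb.
apply/setP=> s; rewrite !inE -(val_eqE s p) -(val_eqE s q) -(val_eqE s r) /=.
rewrite Ep Eq Er.
apply/idP/idP => [sb|]; last first.
  by rewrite -orbA => /or3P[] /eqP->; rewrite Eb !subUset !sub1set !inE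
    !eqxx ?orbT.
have : #|supp b :\: val s| == 1%N.
  by rewrite cardsD (setIidPr sb) (eqP (valP b)) (eqP (valP s)).
case/cards1P=> x Ex; have sE : val s = supp b :\ x.
  by rewrite -Ex setDDr setDv set0U (setIidPr sb).
have : x \in supp b by have := set11 x; rewrite -Ex inE => /andP[].
rewrite Eb !inE -orbA => /or3P[] /eqP Ex'; rewrite sE Eb Ex'.
- apply/orP; right; apply/eqP/setP=> z; rewrite !inE.
  by case: (eqVneq z i) => [->|//=]; rewrite (negPf nij) (negPf nik).
- apply/orP; left; apply/orP; right; apply/eqP/setP=> z; rewrite !inE.
  case: (eqVneq z j) => [->|] /=; rewrite ?orbF //.
  by rewrite eq_sym (negPf nij) (negPf njk).
- apply/orP; left; apply/orP; left; apply/eqP/setP=> z; rewrite !inE.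
  case: (eqVneq z k) => [->|] /=; rewrite ?orbF //.
  by rewrite eq_sym (negPf nik) eq_sym (negPf njk).
Qed.

Lemma G2mul_evec (i j k : 'I_m) (p q r : point) (b : block) :
    uniq [:: i; j; k] ->
    val p = [set i; j] -> val q = [set i; k] -> val r = [set j; k] ->
    supp b = [set i; j; k] ->
  G2mul (evec K p) (evec K q) = sgn K delta b *: evec K r.
Proof.
move=> Uijk Ep Eq Er Eb; rewrite [LHS]gmul_evec.
apply: gmul_basis_block (points_ofE Uijk Ep Eq Er Eb) _ => [b'|].
  rewrite !inE Ep Eq => pb qb; apply/val_inj/esym/eqP.
  rewrite -[val b]/(supp b) eqEcard (eqP (valP b')) (eqP (valP b)) leqnn andbT.
  rewrite Eb !subUset !sub1set in pb qb *.
  by case/andP: pb => -> ->; case/andP: qb.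
move: Uijk; rewrite /= !inE !negb_or !andbT => /andP[/andP[nij nik] njk].
have neqs (s t : point) x : x \in val s -> x \notin val t -> s != t.
  by move=> xs; apply: contraNneq => <-.
apply/andP; split; first apply/andP; first split.
- by apply: (neqs _ _ j); rewrite ?Ep ?Eq !inE ?eqxx ?orbT // eq_sym negb_or nij.
- by apply: (neqs _ _ i); rewrite ?Ep ?Er !inE ?eqxx // negb_or nij.
- by apply: (neqs _ _ i); rewrite ?Eq ?Er !inE ?eqxx // negb_or nij.
Qed.

Lemma G2mul_evec_same p : G2mul (evec K p) (evec K p) = 0.
Proof. by rewrite [LHS]gmul_evec gmul_basis0. Qed.

Lemma G2mul_evec_disjoint (p q : point) :
  [disjoint val p & val q] -> G2mul (evec K p) (evec K q) = 0.
Proof.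
move=> dpq; rewrite [LHS]gmul_evec gmul_basis0 // => b; rewrite !inE => pb qb.
have : (#|val p :|: val q| <= 3)%N.
  by rewrite -(eqP (valP b)) subset_leq_card // subUset pb.
rewrite cardsU (eqP (valP p)) (eqP (valP q)).
by move: dpq; rewrite -setI_eq0 => /eqP->; rewrite cards0.
Qed.

End Grassmannian.

Definition star_axes (K : fieldType) (m : nat) (omega : 'I_m) :
    seq (galg K (point m)) :=
  [seq G2idem K (star_decoration omega) b |
    b in [pred b : block m | omega \in supp b]].

Definition star_Lambda (K : fieldType) : seq K :=
  [:: 1; - 2^-1; 0; -1; 2^-1].

(* Rows and columns are in the order of star_Lambda. *)
Definition star_fusion_table (K : fieldType) : seq (seq (seq K)) :=
  let h : K := 2^-1 in
  [:: [:: [:: 1];   [:: - h];    [::];       [:: -1];     [:: h]          ];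
      [:: [:: - h]; [:: 1; - h]; [::];       [:: h];      [:: -1; h]      ];
      [:: [::];     [::];        [:: 0];     [:: -1; h];  [:: -1; h]      ];
      [:: [:: -1];  [:: h];      [:: -1; h]; [:: 1; 0];   [:: - h; 0]     ];
      [:: [:: h];   [:: -1; h];  [:: -1; h]; [:: - h; 0]; [:: 1; - h; 0]  ]].

Definition star_fusion (K : fieldType) (l k : K) : seq K :=
  nth [::] (nth [::] (star_fusion_table K) (index l (star_Lambda K)))
    (index k (star_Lambda K)).

Lemma star_fusionC (K : fieldType) (l k : K) :
  star_fusion l k = star_fusion k l.
Proof.
rewrite /star_fusion; move: (index l _) (index k _) => i j.
by case: i => [|[|[|[|[|i]]]]]; case: j => [|[|[|[|[|j]]]]];
  rewrite //= ?nth_nil.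
Qed.

Definition star_spectrum (K : fieldType) (m : nat) : seq K :=
  1 :: nseq (m - 3) (-1) ++ nseq (2 * (m - 3))%N 2^-1
    ++ nseq 2 (- 2^-1) ++ nseq 'C(m - 3, 2) 0.

(* Main.v *)
(* Let c be the axis of the block {omega, a, b} and write ij for e_ij. An
   eigenbasis of L(c) consists of wa + wb + ab (eigenvalue 1), ak + bk - wk (-1),
   wk + ak and wk + bk (1/2), wa - ab and wb - ab (-1/2), and the kl (0), with
   w = omega and k, l outside the block. The form <x, y> = sum_p x_p y_p is
   associative, <xy, z> = <x, yz>, and L(c) is self-adjoint for it, so the fusion
   law says that the symmetric trilinear form <xy, z> vanishes on forbidden
   triples of eigenspaces. The supports of the eigenvectors settle most triples,
   since in a block the three points meet {omega, a, b} in j+h, i+h and i+j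
   indices with i, j, h in {0, 1}; eigenvalue 1 is settled by orthogonality of
   eigenspaces, and the triple (-1/2, -1, -1) by one computation. For generation,
   with f_ij = wi + wj + ij one has f_ij + f_ik + f_ij f_ik = 2 wi. *)
Require Import Defs.
From mathcomp Require Import all_boot all_order all_algebra.
From mathcomp Require Import ring zify.
Import GRing.Theory passmx.
Local Open Scope ring_scope.

Set Implicit Arguments.
Unset Strict Implicit.
Unset Printing Implicit Defensive.

(** * Endomorphisms with a spanning list of (eigenvalue, eigenvector) pairs as long as the
    dimension *)

Section Eigenbasis.

Variables (K : fieldType) (V : vectType K) (f : 'End(V)) (s : seq (K * V)).

Hypothesis s_eigen : {in s, forall lv, f lv.2 = lv.1 *: lv.2}.
Hypothesis s_span : (<<unzip2 s>> = fullv)%VS.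
Hypothesis s_size : size s = \dim {:V}.

Let n := \dim {:V}.
Let sizeX : size (unzip2 s) == n.
Proof. by rewrite size_map s_size. Qed.
Let X : n.-tuple V := Tuple sizeX.
Let L (i : nat) : K := (unzip1 s)`_i.

Let X_basis : basis_of {:V} X.
Proof. by rewrite basisEdim s_span subvv size_map s_size leqnn. Qed.

Let fX (i : 'I_n) : f X`_i = L i *: X`_i.
Proof.
have lti : (i < size s)%N by rewrite s_size.
by rewrite /L /X /= !(nth_map (0, 0)) //; apply/s_eigen/mem_nth.
Qed.

Let mxof_diag : mxof X X f = diag_mx (\row_i L i).
Proof.
apply/row_matrixP => i; rewrite rowE mul_mxof vecof_delta fX linearZ /=.
by rewrite rVofE // row_diag_mx mxE.
Qed.

Let vb_basis : basis_of {:V} (vbasis {:V}) := vbasisP _.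

Let mxof_inv (e e' : n.-tuple V) : basis_of {:V} e -> basis_of {:V} e' ->
  mxof e e' \1%VF *m mxof e' e \1%VF = 1%:M.
Proof.
by move=> be be'; rewrite -mxof_comp // comp_lfun1l mxof1 // (basis_free be).
Qed.

Let P := mxof (vbasis {:V}) X \1%VF.
Let Q := mxof X (vbasis {:V}) \1%VF.
Let D : 'M[K]_n := diag_mx (\row_i L i).

Let endmxE : endmx f = P *m D *m Q.
Proof.
by rewrite /P /Q /D -mxof_diag -!mxof_comp // comp_lfun1l comp_lfun1r.
Qed.

Let PQ : P *m Q = 1%:M. Proof. exact: mxof_inv. Qed.

(** [P] and [Q] are the base changes between the fixed basis and the eigenvectors. As [P *m Q = 1],
    the matrix of [f] is conjugate to the diagonal matrix [D], and conjugation does not change the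
    determinant. *)
Lemma eigenbasis_char_poly :
  char_poly (endmx f) = \prod_(a <- unzip1 s) ('X - a%:P).
Proof.
have eq1 : char_poly (endmx f) = char_poly D.
  rewrite /char_poly.
  have -> : char_poly_mx (endmx f) =
    map_mx polyC P *m char_poly_mx D *m map_mx polyC Q.
    rewrite /char_poly_mx endmxE mulmxBr mulmxBl !map_mxM /=.
    (* The scalar matrix of the indeterminate commutes with [P], so conjugation fixes it. *)
    by congr (_ - _); rewrite scalar_mxC -mulmxA -map_mxM PQ map_mx1 mulmx1.
  by rewrite !det_mulmx mulrAC -det_mulmx -map_mxM PQ map_mx1 det1 mul1r.
rewrite eq1 char_poly_trig ?diag_mx_is_trig // (big_nth 0) big_mkord.
rewrite size_map s_size; apply: eq_bigr => i _.
by rewrite !mxE eqxx.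
Qed.

Lemma eigenbasis_diagonalizable : diagonalizable (endmx f).
Proof.
have Pu : P \in unitmx by case: (mulmx1_unit PQ).
have Qu : Q \in unitmx by case: (mulmx1_unit PQ).
have QE : invmx Q = P by rewrite -[LHS]mul1mx -PQ mulmxK.
exists Q => //; apply/(diagonalizable_forLR Qu); exists (\row_i L i).
by rewrite [RHS](conjVmx _ Qu) endmxE QE.
Qed.

(** Comparing coordinates in [f x = l *: x] kills the coordinate of [x] at every listed vector whose
    eigenvalue is not [l]. *)
Lemma eigenbasis_leigenspace l :
  leigenspace f l = <<[seq lv.2 | lv <- s & lv.1 == l]>>%VS.
Proof.
apply: subv_anti; apply/andP; split; last first.
  apply/span_subvP => v /mapP[lv]; rewrite mem_filter => /andP[/eqP <- lvs] ->.
  by rewrite memv_ker add_lfunE opp_lfunE scale_lfunE id_lfunE s_eigen ?subrr.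
apply/subvP => x.
rewrite memv_ker add_lfunE opp_lfunE scale_lfunE id_lfunE => /eqP fx.
have xE := coord_basis X_basis (memvf x).
have c0 (i : 'I_n) : L i != l -> coord X i x = 0.
  move=> Li; have : \sum_(j < n) ((L j - l) * coord X j x) *: X`_j = 0.
    rewrite -[RHS]fx [in RHS]xE linear_sum scaler_sumr -sumrB.
    apply: eq_bigr => j _; rewrite linearZ /= fX.
    by rewrite !scalerA mulrBl scalerBl [_ * coord _ _ _]mulrC.
  move/(congr1 (coord X i)); rewrite coord_sum_free ?(basis_free X_basis) //.
  by rewrite linear0 => /eqP; rewrite mulf_eq0 subr_eq0 (negPf Li) => /eqP.
rewrite xE; apply: rpred_sum => i _.
have [Li|/c0->] := eqVneq (L i) l; last by rewrite scale0r mem0v.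
have lti : (i < size s)%N by rewrite s_size.
apply/rpredZ/memv_span/mapP; exists (nth (0, 0) s i).
  by rewrite mem_filter mem_nth // andbT -Li /L (nth_map (0, 0)).
by rewrite /X /= (nth_map (0, 0)).
Qed.

Lemma eigenbasis_leigenvalue l : leigenvalue f l -> l \in unzip1 s.
Proof.
rewrite /leigenvalue eigenbasis_leigenspace => nz.
apply: contraNT nz => ls; rewrite (_ : filter _ _ = [::]) ?span_nil //.
apply/eqP; rewrite -[_ == _]negbK -has_filter; apply: contra ls.
by case/hasP=> lv lvs /eqP <-; apply: map_f.
Qed.

End Eigenbasis.

(** * The standard symmetric form and endomorphisms self-adjoint for it *)

Section FrobeniusForm.

Variables (K : fieldType) (P : finType).
Implicit Types x y z : galg K P.

Definition dotg x y : K := \sum_p x p * y p.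

Lemma dotgC x y : dotg x y = dotg y x.
Proof. by apply: eq_bigr => p _; rewrite mulrC. Qed.

Lemma dotgDl x y z : dotg (x + y) z = dotg x z + dotg y z.
Proof.
by rewrite -big_split; apply: eq_bigr => p _; rewrite ffunE mulrDl.
Qed.

Lemma dotgZl a x z : dotg (a *: x) z = a * dotg x z.
Proof.
by rewrite /dotg big_distrr; apply: eq_bigr => p _; rewrite ffunE -mulrA.
Qed.

Lemma dotgNl x z : dotg (- x) z = - dotg x z.
Proof. by rewrite -scaleN1r dotgZl mulN1r. Qed.

Lemma dotgZr a x z : dotg z (a *: x) = a * dotg z x.
Proof. by rewrite dotgC dotgZl dotgC. Qed.

Lemma dot0g x : dotg 0 x = 0.
Proof. by rewrite -(scale0r x) dotgZl mul0r. Qed.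

Lemma dotg_evec x p : dotg x (evec K p) = x p.
Proof.
rewrite /dotg (bigD1 p) //= ffunE eqxx mulr1 big1 ?addr0 // => q /negPf nq.
by rewrite ffunE nq mulr0.
Qed.

Lemma dotg_span (X : seq (galg K P)) z y :
  y \in <<X>>%VS -> {in X, forall v, dotg z v = 0} -> dotg z y = 0.
Proof.
move=> /(@coord_span _ _ _ (in_tuple X)) -> zX; rewrite dotgC.
apply: (big_ind (fun w => dotg w z = 0)) => [|u v uz vz|i _].
- exact: dot0g.
- by rewrite dotgDl uz vz addr0.
- by rewrite dotgZl dotgC zX ?mulr0 // mem_nth.
Qed.

Lemma galg_expand x : x = \sum_p x p *: evec K p.
Proof.
apply/ffunP => q; rewrite sum_ffunE (bigD1 q) //= !ffunE eqxx.
rewrite [_ *: _]mulr1 big1 ?addr0 // => p /negPf np.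
by rewrite !ffunE eq_sym np [_ *: _]mulr0.
Qed.

Lemma evec_generate (U : {vspace galg K P}) :
  (forall p, evec K p \in U) -> U = {:galg K P}%VS.
Proof.
move=> Ue; apply/vspaceP => x; rewrite memvf (galg_expand x).
by apply: rpred_sum => p _; apply: rpredZ.
Qed.

Lemma dim_galg : \dim {:galg K P} = #|P|.
Proof. by rewrite dimvf /dim /= muln1. Qed.

Variable f : 'End(galg K P).
Hypothesis f_adj : forall x y, dotg (f x) y = dotg x (f y).

Lemma leigenspace_app l x : x \in leigenspace f l -> f x = l *: x.
Proof.
by rewrite memv_ker add_lfunE opp_lfunE scale_lfunE id_lfunE subr_eq0 => /eqP.
Qed.

Lemma leigenspace_orthogonal l k x y : l != k ->
  x \in leigenspace f l -> y \in leigenspace f k -> dotg x y = 0.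
Proof.
move=> nlk /leigenspace_app fx /leigenspace_app fy.
have /eqP := f_adj x y; rewrite fx fy dotgZl dotgZr -subr_eq0 -mulrBl.
by rewrite mulf_eq0 subr_eq0 (negPf nlk) => /eqP.
Qed.

(** The filter [Q] serves two sums below: over the values in a list, and over the eigenvalues
    outside it. *)
Lemma sum_leigenspace_orthogonal (r : seq K) (Q : pred K) k x y :
    (forall l, Q l -> l != k) ->
    x \in (\sum_(l <- r | Q l) leigenspace f l)%VS ->
    y \in leigenspace f k -> dotg x y = 0.
Proof.
move=> Qk xr yk; pose orth (U : {vspace galg K P}) :=
  forall z, z \in U -> dotg z y = 0.
suff: orth (\sum_(l <- r | Q l) leigenspace f l)%VS by apply.
elim/big_rec: _ => [z|l U Ql IH z].
  by rewrite memv0 => /eqP->; exact: dot0g.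
case/memv_addP=> u ul [v vU ->]; rewrite dotgDl (IH v) // addr0.
exact: leigenspace_orthogonal (Qk l Ql) ul yk.
Qed.

(* The component of z in the remaining eigenspaces is orthogonal to every
   eigenspace, hence zero. *)
Lemma mem_sum_leigenspace (s : seq (K * galg K P)) (r : seq K) z :
    {in s, forall lv, f lv.2 = lv.1 *: lv.2} ->
    (<<unzip2 s>> = fullv)%VS ->
    (forall k v, k \in unzip1 s -> k \notin r -> v \in leigenspace f k ->
      dotg z v = 0) ->
  z \in (\sum_(l <- r) leigenspace f l)%VS.
Proof.
move=> s_eigen s_span zr.
have s_mem lv : lv \in s -> lv.2 \in leigenspace f lv.1.
  move/s_eigen=> fv.
  by rewrite memv_ker add_lfunE opp_lfunE scale_lfunE id_lfunE fv subrr.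
have sup (r' : seq K) (Q : pred K) k : Q k -> k \in r' ->
    (leigenspace f k <= \sum_(l <- r' | Q l) leigenspace f l)%VS.
  by move=> Qk kr; rewrite (big_rem k) //= Qk addvSl.
pose U1 := (\sum_(l <- r) leigenspace f l)%VS.
pose U2 := (\sum_(l <- unzip1 s | l \notin r) leigenspace f l)%VS.
(* The eigenvectors span, so [z] splits into an allowed part in [U1] and a forbidden part in
   [U2]. *)
have: z \in (U1 + U2)%VS.
  apply: (subvP _ z (memvf z)); rewrite -s_span; apply/span_subvP => v.
  case/mapP=> lv lvs ->; have lv1 : lv.1 \in unzip1 s by apply: map_f.
  have [lr|lr] := boolP (lv.1 \in r).
    by apply: (subvP (addvSl _ _)); apply: subvP (s_mem _ lvs); apply: sup.
  by apply: (subvP (addvSr _ _)); apply: subvP (s_mem _ lvs); apply: sup.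
case/memv_addP=> u1 u1r [u2 u2r zE].
suff u20 : u2 = 0 by rewrite zE u20 addr0.
(* Coordinates are pairings with basis vectors, so orthogonality to a spanning set gives 0; no
   positivity of the form is involved. *)
apply/ffunP => p; rewrite ffunE -dotg_evec.
apply: (@dotg_span (unzip2 s)); first by rewrite s_span memvf.
move=> v /mapP[lv lvs ->]; have lv1 : lv.1 \in unzip1 s by apply: map_f.
have [lr|lr] := boolP (lv.1 \in r).
  apply: sum_leigenspace_orthogonal u2r (s_mem _ lvs) => k.
  by apply: contraNneq => ->.
(* Against a forbidden eigenvector, [z] pairs to 0 by hypothesis and [u1] by orthogonality of
   eigenspaces. *)
rewrite (_ : u2 = z - u1); last by rewrite zE addrC addKr.
rewrite dotgDl dotgNl (zr lv.1) ?s_mem // sub0r.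
apply/eqP; rewrite oppr_eq0; apply/eqP.
move: u1r; rewrite /U1 big_seq => u1r.
apply: sum_leigenspace_orthogonal u1r (s_mem _ lvs) => k kr.
by apply: contraNneq lr => <-.
Qed.

End FrobeniusForm.

(** * Structure constants and associativity of the form *)

Section StructureConstants.

Variables (K : fieldType) (P B : finType) (pts : B -> {set P}).
Variable delta : B -> bool.
Implicit Types x y z : galg K P.

(** The coefficient of [evec K r] in the product of [evec K p] and [evec K q], written so that its
    symmetry in the three points is visible. *)
Definition gcoef p q r : K := \sum_(b : B |
  [&& p \in pts b, q \in pts b, r \in pts b & uniq [:: p; q; r]]) sgn K delta b.

Lemma gcoefC p q r : gcoef p q r = gcoef q p r.
Proof.
apply: eq_bigl => b; rewrite /= !inE !negb_or !andbT.
by rewrite [q == p]eq_sym; do 6?case: (_ == _); do 3?case: (_ \in _).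
Qed.

Lemma gcoef_rot p q r : gcoef p q r = gcoef q r p.
Proof.
apply: eq_bigl => b; rewrite /= !inE !negb_or !andbT.
rewrite [q == p]eq_sym [r == p]eq_sym.
by do 6?case: (_ == _); do 3?case: (_ \in _).
Qed.

Lemma gcoef_neq0 p q r : gcoef p q r != 0 ->
  exists2 b, uniq [:: p; q; r] & [&& p \in pts b, q \in pts b & r \in pts b].
Proof.
move=> nz; have [b /and4P[pb qb rb u]|none] := pickP (fun b =>
  [&& p \in pts b, q \in pts b, r \in pts b & uniq [:: p; q; r]]).
  by exists b; rewrite ?pb ?qb ?rb.
by rewrite /gcoef big_pred0 ?eqxx in nz.
Qed.

Lemma gmul_basisE p q r : gmul_basis K pts delta p q r = gcoef p q r.
Proof.
rewrite /gmul_basis sum_ffunE /gcoef [RHS]big_mkcond; apply: eq_bigr => b _.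
rewrite sum_ffunE big_mkcond (bigD1 r) //= !inE !ffunE eqxx.
rewrite [_ *: _]mulr1 [X in _ + X]big1 ?addr0 //= => r' /negPf nr.
by rewrite !ffunE eq_sym nr [_ *: _]mulr0 if_same.
Qed.

Lemma gmulE x y r :
  gmul pts delta x y r = \sum_p \sum_q x p * y q * gcoef p q r.
Proof.
rewrite /gmul sum_ffunE; apply: eq_bigr => p _; rewrite sum_ffunE.
by apply: eq_bigr => q _; rewrite ffunE gmul_basisE.
Qed.

Lemma gmulC : commutative (gmul (K := K) pts delta).
Proof.
move=> x y; apply/ffunP => r; rewrite !gmulE exchange_big /=.
by apply: eq_bigr => q _; apply: eq_bigr => p _; rewrite gcoefC [x p * _]mulrC.
Qed.

Lemma dotg_gmul x y z : dotg (gmul pts delta x y) z =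
  \sum_p \sum_q \sum_r x p * y q * z r * gcoef p q r.
Proof.
transitivity (\sum_r \sum_p \sum_q x p * y q * z r * gcoef p q r).
  apply: eq_bigr => r _; rewrite gmulE big_distrl; apply: eq_bigr => p _.
  by rewrite big_distrl; apply: eq_bigr => q _; rewrite /= mulrAC.
by rewrite exchange_big; apply: eq_bigr => p _; rewrite exchange_big.
Qed.

(** Both sides are the same triple sum, because [gcoef] is invariant under cyclic rotation. *)
Lemma dotg_gmulA x y z :
  dotg (gmul pts delta x y) z = dotg x (gmul pts delta y z).
Proof.
rewrite [RHS]dotgC !dotg_gmul; apply/esym.
under eq_bigr => q _ do rewrite exchange_big.
rewrite exchange_big; apply: eq_bigr => p _; apply: eq_bigr => q _.
apply: eq_bigr => r _; rewrite -gcoef_rot; congr (_ * _).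
by rewrite mulrC mulrA.
Qed.

End StructureConstants.

(** * Products in the star-decorated algebra *)

Section StarAlgebra.

Variables (K : fieldType) (m : nat) (omega : 'I_m).

Local Notation mul := (G2mul K (star_decoration omega)).

(** The sum has at most one term. It makes [edge i j] total, with value 0 for [i = j], so no proof
    of [i != j] is carried around. *)
Definition edge (i j : 'I_m) : galg K (point m) :=
  \sum_(p : point m | val p == [set i; j]) evec K p.

Lemma edgeE (p : point m) i j : val p = [set i; j] -> edge i j = evec K p.
Proof.
by move=> Ep; rewrite /edge (big_pred1 p) // => q; rewrite -Ep -val_eqE.
Qed.

Lemma edgeC i j : edge i j = edge j i.
Proof. by rewrite /edge setUC. Qed.

Lemma point_edge (p : point m) :
  exists i j, [/\ i != j, val p = [set i; j] & evec K p = edge i j].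
Proof.
have /cards2P[i [j [nij Ep]]] := valP p.
by exists i, j; split => //; rewrite (edgeE Ep).
Qed.

Lemma edge_point i j : i != j ->
  exists2 p : point m, val p = [set i; j] & edge i j = evec K p.
Proof.
move=> nij; have cij : #|[set i; j]| == 2%N by rewrite cards2 nij.
by exists (exist _ [set i; j] cij : point m); last apply: edgeE.
Qed.

Lemma mul_edge i j k : uniq [:: i; j; k] -> mul (edge i j) (edge i k) =
  (-1) ^+ (omega \in [:: i; j; k]) *: edge j k.
Proof.
move=> Uijk; have := Uijk; rewrite /= !inE negb_or andbT.
case/andP=> /andP[nij nik] njk.
have [p Ep ->] := edge_point nij; have [q Eq ->] := edge_point nik.
have [r Er ->] := edge_point njk.
have cijk : #|[set i; j; k]| == 3%N.
  by rewrite setUC cardsU1 !inE negb_or ![k == _]eq_sym nik njk cards2 nij.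
rewrite (@G2mul_evec _ _ _ i j k p q r (exist _ [set i; j; k] cijk)) //.
by rewrite /sgn /star_decoration /supp /= !inE orbA.
Qed.

Lemma mul_edge_same i j : i != j -> mul (edge i j) (edge i j) = 0.
Proof. by move=> /edge_point[p _ ->]; apply: G2mul_evec_same. Qed.

Lemma mul_edge_disjoint i j (p : point m) : i != j ->
  i \notin val p -> j \notin val p -> mul (edge i j) (evec K p) = 0.
Proof.
move=> /edge_point[q Eq ->] ip jp; apply: G2mul_evec_disjoint.
rewrite disjoint_subset Eq; apply/subsetP => x.
by rewrite !inE => /orP[] /eqP->.
Qed.

Lemma mul_edge0 i j k l : uniq [:: i; j; k; l] ->
  mul (edge i j) (edge k l) = 0.
Proof.
rewrite /= !inE !negb_or !andbT => /and3P[/and3P[nij nik nil] /andP[njk njl]].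
case/edge_point=> p Ep ->; apply: mul_edge_disjoint; rewrite // Ep !inE.
  by rewrite negb_or nik.
by rewrite negb_or njk.
Qed.

Lemma G2mulC : commutative mul.
Proof. exact: gmulC. Qed.

(* The block idempotent of {omega, a, b}, times -2. *)
Definition star_sum a b := edge omega a + edge omega b + edge a b.

Lemma star_sumC a b : star_sum a b = star_sum b a.
Proof. by rewrite /star_sum [edge b a]edgeC [edge omega b + _]addrC. Qed.

Section Table.

Variables a b : 'I_m.
Hypothesis Uab : uniq [:: omega; a; b].

Let neqs : (a != omega) * (omega != a) * (b != omega) * (omega != b)
   * (a != b) * (b != a).
Proof.
move: Uab; rewrite /= !inE negb_or andbT => /andP[/andP[h1 h2] h3].
by rewrite h1 h2 h3 eq_sym h1 eq_sym h2 eq_sym h3.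
Qed.

Lemma star_sum_mul_omega :
  mul (star_sum a b) (edge omega a) = - edge a b - edge omega b.
Proof.
rewrite !linearDl /= mul_edge_same ?neqs // add0r.
rewrite mul_edge ?inE ?eqxx //= ?inE ?negb_or ?neqs // expr1 scaleN1r.
rewrite [edge omega a]edgeC.
rewrite mul_edge ?inE ?eqxx ?orbT //= ?inE ?negb_or ?neqs //.
by rewrite expr1 scaleN1r [edge b a]edgeC [edge b omega]edgeC.
Qed.

Lemma star_sum_mul_base :
  mul (star_sum a b) (edge a b) = - edge omega a - edge omega b.
Proof.
rewrite !linearDl /= mul_edge_same ?neqs // addr0.
rewrite [edge omega a]edgeC.
rewrite mul_edge ?inE ?eqxx ?orbT //= ?inE ?negb_or ?neqs //.
rewrite [edge omega b]edgeC [edge a b]edgeC.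
rewrite mul_edge ?inE ?eqxx ?orbT //= ?inE ?negb_or ?neqs //.
rewrite expr1 !scaleN1r addrC.
by rewrite [edge b omega]edgeC [edge a omega]edgeC.
Qed.

Section Outside.

Variable k : 'I_m.
Hypothesis k_out : k \notin [set omega; a; b].

Let neqk : (k != omega) * (omega != k) * (k != a) * (a != k)
   * (k != b) * (b != k).
Proof.
move: k_out; rewrite !inE !negb_or => /andP[/andP[h1 h2] h3].
by rewrite h1 h2 h3 eq_sym h1 eq_sym h2 eq_sym h3.
Qed.

Lemma star_sum_mul_omega_out :
  mul (star_sum a b) (edge omega k) = - edge a k - edge b k.
Proof.
rewrite !linearDl /= mul_edge ?inE ?eqxx //= ?inE ?negb_or ?neqs ?neqk //.
rewrite mul_edge ?inE ?eqxx //= ?inE ?negb_or ?neqs ?neqk //.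
rewrite mul_edge0 /= ?inE ?negb_or ?neqs ?neqk //.
by rewrite addr0 expr1 !scaleN1r.
Qed.

(** The block [{a, b, k}] misses [omega], whence the plus sign; [edge omega b] and [edge a k] are
    disjoint. *)
Lemma star_sum_mul_base_out :
  mul (star_sum a b) (edge a k) = - edge omega k + edge b k.
Proof.
rewrite !linearDl /= [edge omega a]edgeC.
rewrite mul_edge ?inE ?eqxx ?orbT //= ?inE ?negb_or ?neqs ?neqk //.
rewrite mul_edge0 /= ?inE ?negb_or ?neqs ?neqk //.
rewrite mul_edge //= ?inE ?negb_or ?neqs ?neqk //.
have -> : [|| omega == a, omega == b | omega == k] = false.
  by apply: negbTE; rewrite !negb_or !neqs !neqk.
by rewrite addr0 expr1 scaleN1r expr0 scale1r.
Qed.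

(** Up to sign the result is a 1/2-eigenvector, hence orthogonal to the (-1)-eigenspace. *)
Lemma minus_half_mul_minus_one :
  mul (edge omega a - edge a b) (edge a k + edge b k - edge omega k) =
  - (edge omega k + edge b k).
Proof.
rewrite linearBl /= !linearBr /= !linearDr /=.
have -> : mul (edge omega a) (edge omega k) = - edge a k.
  rewrite mul_edge ?inE ?eqxx //= ?inE ?negb_or ?neqs ?neqk //.
  by rewrite expr1 scaleN1r.
have -> : mul (edge omega a) (edge a k) = - edge omega k.
  rewrite [edge omega a]edgeC.
  rewrite mul_edge ?inE ?eqxx ?orbT //= ?inE ?negb_or ?neqs ?neqk //.
  by rewrite expr1 scaleN1r.
have -> : mul (edge omega a) (edge b k) = 0.
  by rewrite mul_edge0 //= ?inE ?negb_or ?neqs ?neqk.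
have -> : mul (edge a b) (edge omega k) = 0.
  by rewrite mul_edge0 //= ?inE ?negb_or ?neqs ?neqk.
have off i j : [|| omega == i, omega == j | omega == k] =
    ~~ [&& omega != i, omega != j & omega != k].
  by rewrite !negb_and !negbK.
have -> : mul (edge a b) (edge a k) = edge b k.
  rewrite mul_edge //= ?inE ?negb_or ?neqs ?neqk //.
  by rewrite off !neqs !neqk expr0 scale1r.
have -> : mul (edge a b) (edge b k) = edge a k.
  rewrite [edge a b]edgeC mul_edge //= ?inE ?negb_or ?neqs ?neqk //.
  by rewrite off !neqs !neqk expr0 scale1r.
by apply/ffunP => q; rewrite !ffunE; ring.
Qed.

End Outside.

Lemma star_sum_mul_disjoint (p : point m) :
  [disjoint val p & [set omega; a; b]] -> mul (star_sum a b) (evec K p) = 0.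
Proof.
rewrite disjoint_sym disjoint_subset => /subsetP dp.
have [oP aP bP] : [/\ omega \notin val p, a \notin val p & b \notin val p].
  by split; apply: dp; rewrite !inE eqxx ?orbT.
by rewrite !linearDl /= !mul_edge_disjoint ?neqs // !addr0.
Qed.

End Table.

End StarAlgebra.

Lemma sum_set3 (I : finType) (V : nmodType) (F : I -> V) p q r :
  uniq [:: p; q; r] -> \sum_(i in [set p; q; r]) F i = F p + F q + F r.
Proof.
rewrite /= !inE negb_or andbT => /andP[/andP[npq npr] nqr].
rewrite setUC big_setU1 ?big_setU1 ?big_set1 ?inE //=; first by rewrite addrC.
by rewrite negb_or [r == p]eq_sym npr eq_sym.
Qed.

(** * Distinctness of the five eigenvalues *)

Section CharacteristicZero.

Variable K : fieldType.
Hypothesis charK0 : [pchar K] =i pred0.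

Lemma natr_neq0 n : n.+1%:R != 0 :> K.
Proof. by have /pcharf0P-> := charK0. Qed.

Lemma half_natr_neq0 n : n.+1%:R / 2%:R != 0 :> K.
Proof. by rewrite mulf_neq0 ?invr_eq0 ?natr_neq0. Qed.

(** Up to sign, each difference of two of the values is n/2 with n between 1 and 4. The argument of
    [ne] and [ne'] below is n - 1. *)
Lemma star_Lambda_uniq : uniq (star_Lambda K).
Proof.
have n2 := natr_neq0 1.
have ne n (x y : K) : x - y = n.+1%:R / 2%:R -> x != y.
  by move=> xy; rewrite -subr_eq0 xy half_natr_neq0.
have ne' n (x y : K) : y - x = n.+1%:R / 2%:R -> x != y.
  by rewrite eq_sym; apply: ne.
rewrite /= !inE !negb_or andbT; repeat (apply/andP; split).
- by apply: (ne 2); field.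
- by apply: (ne 1%N); field.
- by apply: (ne 3); field.
- by apply: (ne 0%N); field.
- by apply: (ne' 0%N); field.
- by apply: (ne 0%N); field.
- by apply: (ne' 1%N); field.
- by apply: (ne 1%N); field.
- by apply: (ne' 0%N); field.
- by apply: (ne' 2); field.
Qed.

End CharacteristicZero.

(** * The axis of a block [{omega, a, b}] and its eigenvectors *)

Section Axis.

Variables (K : fieldType) (m : nat) (omega : 'I_m).
Hypothesis charK0 : [pchar K] =i pred0.

Local Notation mul := (G2mul K (star_decoration omega)).
Local Notation edge := (edge K).
Local Notation star_sum := (star_sum K omega).
Local Notation natr_neq0 := (natr_neq0 charK0).

Variables (a b : 'I_m) (blk : block m).
Hypothesis Uab : uniq [:: omega; a; b].
Hypothesis Eblk : supp blk = [set omega; a; b].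

Let T := [set omega; a; b].
Let c := G2idem K (star_decoration omega) blk.
Let L := Lmul mul c.

(** The block contains [omega], so its sign is -1. *)
Lemma axisE : c = - 2^-1 *: star_sum a b.
Proof.
have := Uab; rewrite /= !inE negb_or andbT => /andP[/andP[n1 n2] n3].
have [p Ep eqp] := edge_point K n1; have [q Eq eqq] := edge_point K n2.
have [r Er eqr] := edge_point K n3.
rewrite /c /G2idem /block_idem (points_ofE Uab Ep Eq Er Eblk).
rewrite /sgn /star_decoration Eblk !inE eqxx /= expr1 mulrN1.
congr (_ *: _); rewrite /star_sum eqp eqq eqr.
apply: sum_set3; rewrite /= !inE negb_or andbT; apply/andP; split.
  apply/andP; split; apply/eqP => pqr.
    have: a \in val q by rewrite -pqr Ep !inE eqxx orbT.
    by rewrite Eq !inE eq_sym (negPf n1) (negPf n3).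
  have: omega \in val r by rewrite -pqr Ep !inE eqxx.
  by rewrite Er !inE (negPf n1) (negPf n2).
apply/eqP => qr; have: omega \in val r by rewrite -qr Eq !inE eqxx.
by rewrite Er !inE (negPf n1) (negPf n2).
Qed.

Lemma axis_app x : L x = - 2^-1 *: mul (star_sum a b) x.
Proof. by rewrite lfunE /= axisE [LHS]linearZl_LR. Qed.

Definition outside : {set 'I_m} := ~: T.
Definition remote : {set point m} := [set p : point m | [disjoint val p & T]].

(** The families follow the order of [star_spectrum], so the eigenvalue list equals it on the nose
    and not just up to permutation. *)
Definition eigenbasis : seq (K * galg K (point m)) :=
  (1, star_sum a b)
  :: [seq (-1, edge a k + edge b k - edge omega k) | k <- enum outside]
  ++ [seq (2^-1, edge omega k + edge a k) | k <- enum outside]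
  ++ [seq (2^-1, edge omega k + edge b k) | k <- enum outside]
  ++ [:: (- 2^-1, edge omega a - edge a b); (- 2^-1, edge omega b - edge a b)]
  ++ [seq (0, evec K p) | p <- enum remote].

Inductive eigenbasis_spec : K * galg K (point m) -> Prop :=
| EigenOne : eigenbasis_spec (1, star_sum a b)
| EigenMinusOne k of k \notin T :
    eigenbasis_spec (-1, edge a k + edge b k - edge omega k)
| EigenHalfL k of k \notin T : eigenbasis_spec (2^-1, edge omega k + edge a k)
| EigenHalfR k of k \notin T : eigenbasis_spec (2^-1, edge omega k + edge b k)
| EigenMinusHalfL : eigenbasis_spec (- 2^-1, edge omega a - edge a b)
| EigenMinusHalfR : eigenbasis_spec (- 2^-1, edge omega b - edge a b)
| EigenZero (p : point m) of [disjoint val p & T] :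
    eigenbasis_spec (0, evec K p).

Lemma eigenbasisP lv : reflect (eigenbasis_spec lv) (lv \in eigenbasis).
Proof.
rewrite /eigenbasis inE !mem_cat !inE; apply: (iffP idP) => [|[]].
- case/or3P=> [/eqP->|/mapP[k kT ->]|/or4P[/mapP[k kT ->]|/mapP[k kT ->]||]].
  + exact: EigenOne.
  + by apply: EigenMinusOne; rewrite mem_enum inE in kT.
  + by apply: EigenHalfL; rewrite mem_enum inE in kT.
  + by apply: EigenHalfR; rewrite mem_enum inE in kT.
  + by case/orP=> /eqP->; [apply: EigenMinusHalfL | apply: EigenMinusHalfR].
  + case/mapP=> p pT ->; apply: EigenZero.
    by rewrite mem_enum inE in pT.
- by rewrite eqxx.
- by move=> k kT; rewrite (map_f (fun k => (_, _ + edge b k - _))) ?orbT //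
    mem_enum inE.
- move=> k kT.
  rewrite [X in [|| _, _, X | _]](map_f (fun k => (_, _ + edge a k))) ?orbT //.
  by rewrite mem_enum inE.
- move=> k kT.
  rewrite [X in [|| _, _, _, X | _]](map_f (fun k => (_, _ + edge b k))) ?orbT //.
  by rewrite mem_enum inE.
- by rewrite eqxx ?orbT.
- by rewrite eqxx ?orbT.
- by move=> p pT; rewrite (map_f (fun p => (_, evec K p))) ?orbT // mem_enum inE.
Qed.

Let Uba : uniq [:: omega; b; a].
Proof.
move: Uab; rewrite /= !inE !negb_or !andbT => /andP[/andP[-> ->]].
by rewrite eq_sym => ->.
Qed.

Let Tba : [set omega; b; a] = T.
Proof. by rewrite /T setUAC. Qed.

Lemma eigenbasis_eigen : {in eigenbasis, forall lv, L lv.2 = lv.1 *: lv.2}.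
Proof.
have n2 := natr_neq0 1.
(* Exchanging [a] and [b] preserves [star_sum a b], so each product involving [b] follows from the
   one involving [a]. *)
have Sa := star_sum_mul_omega K Uab; have Sb := star_sum_mul_omega K Uba.
have Sab := star_sum_mul_base K Uab.
rewrite star_sumC [edge b a]edgeC in Sb.
have out k : k \notin T -> [/\
    mul (star_sum a b) (edge omega k) = - edge a k - edge b k,
    mul (star_sum a b) (edge a k) = - edge omega k + edge b k &
    mul (star_sum a b) (edge b k) = - edge omega k + edge a k].
  move=> kT; split; first exact: star_sum_mul_omega_out.
    exact: star_sum_mul_base_out.
  rewrite star_sumC; apply: star_sum_mul_base_out => //.
  by rewrite Tba.
move=> _ /eigenbasisP[|k /out[So Ska Skb]|k /out[So Ska _]|k /out[So _ Skb]|
  ||p pT] /=; rewrite axis_app.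
- rewrite {2}/star_sum !linearDr /= Sa Sb Sab /star_sum.
  by apply/ffunP => q; rewrite !ffunE /GRing.scale /=; field.
- rewrite linearBr linearDr /= So Ska Skb.
  by apply/ffunP => q; rewrite !ffunE /GRing.scale /=; field.
- rewrite linearDr /= So Ska.
  by apply/ffunP => q; rewrite !ffunE /GRing.scale /=; field.
- rewrite linearDr /= So Skb.
  by apply/ffunP => q; rewrite !ffunE /GRing.scale /=; field.
- rewrite linearBr /= Sa Sab.
  by apply/ffunP => q; rewrite !ffunE /GRing.scale /=; field.
- rewrite linearBr /= Sb Sab.
  by apply/ffunP => q; rewrite !ffunE /GRing.scale /=; field.
- by rewrite (star_sum_mul_disjoint K Uab pT) scaler0 scale0r.
Qed.

Lemma eigenbasis_span : (<<unzip2 eigenbasis>> = fullv)%VS.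
Proof.
set U := (<<_>>)%VS.
have Umem lv : eigenbasis_spec lv -> lv.2 \in U.
  by move/eigenbasisP=> ?; apply/memv_span/map_f.
have Uscale n x : n.+1%:R *: x \in U -> x \in U.
  by move/(rpredZ n.+1%:R^-1); rewrite scalerA mulVf ?natr_neq0 ?scale1r.
have f1 := Umem _ EigenOne; have g1 := Umem _ EigenMinusHalfL.
have g2 := Umem _ EigenMinusHalfR; rewrite /= in f1 g1 g2.
have Uab' : edge a b \in U.
  (* [Uscale 2] divides by 3, which characteristic 0 permits. Once [edge a b] is in [U], the
     (-1/2)-eigenvectors give the other two edges of the block. *)
  apply: (Uscale 2); have -> : 3%:R *: edge a b = star_sum a b
      - (edge omega a - edge a b) - (edge omega b - edge a b).
    by apply/ffunP => q; rewrite !ffunE /GRing.scale /=; ring.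
  by rewrite rpredB // rpredB.
have Ua : edge omega a \in U by rewrite -(subrK (edge a b) (edge _ _)) rpredD.
have Ub : edge omega b \in U by rewrite -(subrK (edge a b) (edge _ b)) rpredD.
have Uk k : k \notin T ->
    [/\ edge omega k \in U, edge a k \in U & edge b k \in U].
  move=> kT; have := Umem _ (EigenMinusOne kT).
  have := Umem _ (EigenHalfL kT); have := Umem _ (EigenHalfR kT).
  rewrite /= => h1 h2 h3; have Uo : edge omega k \in U.
    (* The two 1/2-eigenvectors minus the (-1)-eigenvector leave three times [edge omega k]. *)
    apply: (Uscale 2); have -> : 3%:R *: edge omega k = edge omega k + edge b k
        + (edge omega k + edge a k) - (edge a k + edge b k - edge omega k).
      by apply/ffunP => q; rewrite !ffunE /GRing.scale /=; ring.
    by rewrite rpredB // rpredD.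
  by split; rewrite // -[edge _ k](addKr (edge omega k)) rpredD // rpredN.
apply: evec_generate => p; have [i [j [nij Ep ->]]] := point_edge K p.
have [iT|iT] := boolP (i \in T); have [jT|jT] := boolP (j \in T).
- move: iT jT nij; rewrite !inE -!orbA => /or3P[] /eqP-> /or3P[] /eqP->;
    by rewrite ?eqxx // 1?edgeC // edgeC.
- have [h1 h2 h3] := Uk j jT.
  by move: iT; rewrite !inE -!orbA => /or3P[] /eqP->.
- have [h1 h2 h3] := Uk i iT; rewrite edgeC.
  by move: jT; rewrite !inE -!orbA => /or3P[] /eqP->.
- rewrite (edgeE K Ep); apply: (Umem (0, _)); apply: EigenZero.
  rewrite disjoint_subset Ep; apply/subsetP => x.
  by rewrite !inE => /orP[] /eqP->; rewrite !inE in iT jT.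
Qed.

(** * Dimension count, spectrum and diagonalizability *)

Lemma cardT : #|T| = 3%N.
Proof. by rewrite /T -Eblk (eqP (valP blk)). Qed.

Lemma card_outside : #|outside| = (m - 3)%N.
Proof. by rewrite cardsCs setCK card_ord cardT. Qed.

Lemma card_remote : #|remote| = 'C(m - 3, 2).
Proof.
rewrite -card_outside -cards_draws -(card_imset _ val_inj).
apply: eq_card => A; rewrite !inE; apply/imsetP/andP => [[p pT ->]|[AT cA]].
  by rewrite inE disjoints_subset in pT; split=> //; case: (p).
by exists (exist _ A cA : point m); rewrite // inE disjoints_subset.
Qed.

Lemma card_point : #|{: point m}| = 'C(m, 2).
Proof.
rewrite card_sig -[m in RHS]card_ord -card_draws.
by apply: eq_card => A; rewrite !inE.
Qed.

Lemma eigenbasis_spectrum : unzip1 eigenbasis = star_spectrum K m.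
Proof.
have cst (I : Type) (l : K) (s : seq I) (F : I -> galg K (point m)) :
    unzip1 [seq (l, F i) | i <- s] = nseq (size s) l.
  by elim: s => //= i s ->.
rewrite /eigenbasis /star_spectrum /unzip1 /= !map_cat /= ![map fst _]cst.
by rewrite -!cardE card_outside card_remote mul2n -addnn nseqD -!catA.
Qed.

Lemma eigenbasis_size : size eigenbasis = \dim {:galg K (point m)}.
Proof.
rewrite dim_galg card_point -[LHS](size_map fst) -/(unzip1 _).
rewrite eigenbasis_spectrum /= !size_cat /= !size_nseq.
(* [T] has three elements, so the truncated difference [m - 3] is exact. With n = m - 3 the claim is
   1 + n + 2n + 2 + C(n, 2) = C(n + 3, 2). *)
have: (3 <= m)%N by rewrite -cardT -[X in (_ <= X)%N]card_ord max_card.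
move=> /subnK; set n := (m - 3)%N => <-; rewrite !addn3 !binS !bin1 !bin0; lia.
Qed.

Lemma axis_diagonalizable : diagonalizable (endmx L).
Proof.
exact: eigenbasis_diagonalizable eigenbasis_eigen eigenbasis_span
  eigenbasis_size.
Qed.

Lemma axis_spectrum : Spec_is L (star_spectrum K m).
Proof.
rewrite -eigenbasis_spectrum.
exact: eigenbasis_char_poly eigenbasis_eigen eigenbasis_span eigenbasis_size.
Qed.

(** Linear induction on an eigenspace, which the listed eigenvectors with eigenvalue [l] span; it
    reduces claims on supports and on the trilinear form to those vectors. *)
Lemma axis_leigenspaceP l (v : galg K (point m)) : v \in leigenspace L l ->
  forall Q : galg K (point m) -> Prop,
    (forall x y, Q x -> Q y -> Q (x + y)) -> (forall t x, Q x -> Q (t *: x)) ->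
    Q 0 -> (forall lv, eigenbasis_spec lv -> lv.1 = l -> Q lv.2) -> Q v.
Proof.
rewrite (eigenbasis_leigenspace eigenbasis_eigen eigenbasis_span
  eigenbasis_size).
move=> /(@coord_span _ _ _ (in_tuple _)) -> Q QD QZ Q0 Qs.
apply: big_ind => // i _; apply: QZ.
have /mapP[lv] := mem_nth 0 (ltn_ord i : (i < size _)%N).
by rewrite mem_filter => /andP[/eqP lvl /eigenbasisP lvs] ->; apply: Qs.
Qed.

(** With these values, lookups in [star_fusion] and [eigen_class] compute, and a false equation
    between eigenvalues is refuted by comparing indices. *)
Let Lambda_index : (index 1 (star_Lambda K) = 0)
  * (index (- 2^-1) (star_Lambda K) = 1) * (index 0 (star_Lambda K) = 2)
  * (index (-1) (star_Lambda K) = 3) * (index 2^-1 (star_Lambda K) = 4).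
Proof.
have Lu := star_Lambda_uniq charK0.
have idx i : (i < 5)%N -> index (star_Lambda K)`_i (star_Lambda K) = i.
  by move=> i5; apply: index_uniq.
by do !split; [apply: (idx 0) | apply: (idx 1%N) | apply: (idx 2)
  | apply: (idx 3) | apply: (idx 4)].
Qed.

Let eq_index (l k : K) :
  l = k -> index l (star_Lambda K) = index k (star_Lambda K).
Proof. by move->. Qed.

(** * Supports of eigenvectors and the blocks they meet *)

Definition point_class (p : point m) : nat := #|val p :&: T|.

Lemma point_classE p i j : i != j -> val p = [set i; j] ->
  point_class p = ((i \in T) + (j \in T))%N.
Proof.
move=> nij; rewrite /point_class => ->; rewrite setIUl cardsU.
have c1 (x : 'I_m) : #|[set x] :&: T| = (x \in T).
  have [xT|xT] := boolP (x \in T).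
    by rewrite (setIidPl _) ?cards1 // sub1set.
  by apply/eqP; rewrite cards_eq0 setI_eq0 disjoints1.
rewrite !c1 setIACA setIid (_ : [set i] :&: [set j] = set0).
  by rewrite set0I cards0 subn0.
by apply/eqP; rewrite setI_eq0 disjoints1 inE.
Qed.

Lemma edge_support p i j : i != j ->
  point_class p != ((i \in T) + (j \in T))%N -> edge i j p = 0.
Proof.
move=> nij; have [q Eq ->] := edge_point K nij; rewrite ffunE.
by have [->|//] := eqVneq p q; rewrite (point_classE nij Eq) eqxx.
Qed.

(* The number of indices that a point supporting an l-eigenvector shares with
   the support of the axis. *)
Definition eigen_class (l : K) : nat :=
  nth 0 [:: 2; 2; 0; 1; 1]%N (index l (star_Lambda K)).

(** Each listed eigenvector combines edges that share equally many indices with [T]: two for 1 and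
    -1/2, one for -1 and 1/2, none for 0. *)
Lemma axis_support l v p : v \in leigenspace L l ->
  point_class p != eigen_class l -> v p = 0.
Proof.
move=> vl pl; have := Uab.
rewrite /= !inE !negb_or !andbT => /andP[/andP[n1 n2] n3].
have [oT aT bT] : [/\ omega \in T, a \in T & b \in T].
  by rewrite !inE !eqxx ?orbT.
apply: (axis_leigenspaceP vl (Q := fun v => v p = 0)) => {v vl}.
- by move=> x y xp yp; rewrite ffunE xp yp addr0.
- by move=> t x xp; rewrite ffunE xp [LHS]mulr0.
- by rewrite ffunE.
have in_edge i j : i \in T -> j \in T -> i != j -> eigen_class l = 2 ->
    edge i j p = 0.
  move=> iT jT nij cl.
  by apply: edge_support; rewrite // iT jT; rewrite cl in pl.
have cross_edge i k : i \in T -> k \notin T -> eigen_class l = 1%N ->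
    edge i k p = 0.
  move=> iT kT cl; apply: edge_support; first by apply: contraNneq kT => <-.
  by rewrite iT (negPf kT); rewrite cl in pl.
move=> _ [|k kT|k kT|k kT|||q qT] /= El; rewrite !ffunE; last first.
  have [pq|//] := eqVneq p q; move: pl; rewrite pq -El /eigen_class Lambda_index.
  by rewrite /= /point_class cards_eq0 setI_eq0 qT.
all: have cl : eigen_class l = nth 0 [:: 2; 2; 0; 1; 1]%N
  (index l (star_Lambda K)) by [].
all: rewrite -{2}El Lambda_index /= in cl.
all: by [rewrite !in_edge // ?subr0 ?addr0
  | rewrite !cross_edge // ?subr0 ?addr0].
Qed.

(** A point of a block omits exactly one of its three indices, and distinct points omit distinct
    ones; [x], [y], [z] are the indices omitted by [p], [q], [r]. *)
Lemma triangle_points (p q r : point m) (t : block m) :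
    uniq [:: p; q; r] -> p \in points_of t -> q \in points_of t ->
    r \in points_of t ->
  exists x y z, [/\ uniq [:: x; y; z], val p = [set y; z],
    val q = [set x; z] & val r = [set x; y]].
Proof.
have compl (s : point m) : s \in points_of t ->
    exists2 x, x \in supp t & val s = supp t :\ x.
  rewrite inE => st; have : #|supp t :\: val s| == 1%N.
    by rewrite cardsD (setIidPr st) (eqP (valP t)) (eqP (valP s)).
  case/cards1P=> x Ex; exists x.
    by have := set11 x; rewrite -Ex inE => /andP[].
  by rewrite -Ex setDDr setDv set0U (setIidPr st).
move=> Upqr /compl[x xt Ep] /compl[y yt Eq] /compl[z zt Er].
have nxy : x != y.
  by apply: contraTneq Upqr => xy; rewrite /= inE -val_eqE /= Ep Eq xy eqxx.
have nxz : x != z.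
  apply: contraTneq Upqr => xz.
  by rewrite /= !inE -!val_eqE /= Ep Er xz eqxx orbT.
have nyz : y != z.
  apply: contraTneq Upqr => yz.
  by rewrite /= !inE -!val_eqE /= Eq Er yz eqxx andbF.
have Et : supp t = [set x; y; z].
  apply/esym/eqP; rewrite eqEcard !subUset !sub1set xt yt zt (eqP (valP t)).
  by rewrite setUC cardsU1 !inE negb_or ![z == _]eq_sym nxz nyz cards2 nxy.
exists x, y, z; rewrite Ep Eq Er Et /= !inE negb_or nxy nxz nyz; split=> //.
- by rewrite -setUA setU1K // !inE negb_or nxy.
- by rewrite (setUC [set x]) -setUA setU1K // !inE negb_or eq_sym nxy.
- by rewrite setUC setU1K // !inE negb_or ![z == _]eq_sym nxz.
Qed.

(** The booleans record which vertices of a triangle lie in [T]. If no choice of them gives the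
    three classes, every term of the triple sum has a zero factor. *)
Lemma fusion_support l k n x y z :
    (forall i j h : bool, [&& eigen_class l == j + h, eigen_class k == i + h &
      eigen_class n == i + j]%N = false) ->
    x \in leigenspace L l -> y \in leigenspace L k -> z \in leigenspace L n ->
  dotg (mul x y) z = 0.
Proof.
move=> lkn xl yk zn; rewrite [LHS]dotg_gmul.
rewrite big1 // => p _; rewrite big1 // => q _; rewrite big1 // => r _.
have [pl|/(axis_support xl) x0] := eqVneq (point_class p) (eigen_class l);
  last by rewrite x0 !mul0r.
have [qk|/(axis_support yk) y0] := eqVneq (point_class q) (eigen_class k);
  last by rewrite y0 mulr0 !mul0r.
have [rn|/(axis_support zn) z0] := eqVneq (point_class r) (eigen_class n);
  last by rewrite z0 mulr0 !mul0r.
have [->|/gcoef_neq0[t Upqr /and3P[pt qt rt]]] := eqVneq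
  (gcoef K (@points_of m) (star_decoration omega) p q r) 0.
  by rewrite mulr0.
have [i [j [h [Uijh Ep Eq Er]]]] := triangle_points Upqr pt qt rt.
move: Uijh; rewrite /= !inE negb_or andbT => /andP[/andP[nij nih] njh].
have := lkn (i \in T) (j \in T) (h \in T).
rewrite -pl -qk -rn (point_classE njh Ep) (point_classE nih Eq).
by rewrite (point_classE nij Er) !eqxx.
Qed.

(** * Forbidden triples of eigenvalues and the fusion law *)

Definition no_fusion l k n := forall x y z,
  x \in leigenspace L l -> y \in leigenspace L k -> z \in leigenspace L n ->
  dotg (mul x y) z = 0.

Lemma no_fusionC l k n : no_fusion l k n -> no_fusion k l n.
Proof. by move=> H x y z xk yl zn; rewrite [mul x y]G2mulC; apply: H. Qed.

(** Associativity of the form. Together with [no_fusionC] it gives invariance under all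
    permutations, so one ordering of each triple suffices. *)
Lemma no_fusion_rot l k n : no_fusion l k n -> no_fusion k n l.
Proof.
by move=> H x y z xk yn zl; rewrite dotgC -[LHS]dotg_gmulA; apply: H.
Qed.

Lemma axis_adjoint x y : dotg (L x) y = dotg x (L y).
Proof.
by rewrite !lfunE /= [mul c x]G2mulC; apply: dotg_gmulA.
Qed.

(** The 1-eigenspace is the line of the axis, so the product is a multiple of [L y = k *: y], which
    is orthogonal to [z]. *)
Lemma no_fusion_one k n : k != n -> no_fusion 1 k n.
Proof.
move=> nkn x y z x1 yk zn.
apply: (axis_leigenspaceP x1 (Q := fun x => dotg (mul x y) z = 0)).
- by move=> u v uz vz; rewrite linearDl dotgDl uz vz addr0.
- by move=> t u uz; rewrite linearZl_LR dotgZl uz mulr0.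
- by rewrite linear0l dot0g.
have yz : dotg (mul (star_sum a b) y) z = 0.
  have /eqP : dotg (L y) z = 0.
    rewrite (leigenspace_app yk) dotgZl.
    by rewrite (leigenspace_orthogonal axis_adjoint nkn yk zn) mulr0.
  rewrite axis_app dotgZl mulf_eq0 oppr_eq0 invr_eq0 (negPf (natr_neq0 1)).
  by move/eqP.
move=> _ [|h hT|h hT|h hT|||p pT] /=; first by move=> _; exact: yz.
all: move/eq_index; rewrite !Lambda_index; discriminate.
Qed.

(* The products of a (-1/2)-eigenvector with (-1)-eigenvectors are
   1/2-eigenvectors. *)
Lemma no_fusion_minus : no_fusion (- 2^-1) (-1) (-1).
Proof.
move=> x y z xl yk zn.
have half v : v \in eigenbasis -> v.1 = 2^-1 -> dotg v.2 z = 0.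
  move=> vs v1; apply: (leigenspace_orthogonal axis_adjoint _ _ zn (l := 2^-1)).
    apply/eqP => /eq_index.
    by rewrite !Lambda_index.
  rewrite memv_ker add_lfunE opp_lfunE scale_lfunE id_lfunE.
  by rewrite eigenbasis_eigen // v1 subrr.
apply: (axis_leigenspaceP xl (Q := fun x => dotg (mul x y) z = 0)).
- by move=> u v uz vz; rewrite linearDl dotgDl uz vz addr0.
- by move=> t u uz; rewrite linearZl_LR dotgZl uz mulr0.
- by rewrite linear0l dot0g.
move=> g gs g1.
apply: (axis_leigenspaceP yk (Q := fun y => dotg (mul g.2 y) z = 0)).
- by move=> u v uz vz; rewrite linearDr dotgDl uz vz addr0.
- by move=> t u uz; rewrite linearZr_LR dotgZl uz mulr0.
- by rewrite linear0r dot0g.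
move=> h hs h1.
have hE : exists2 k, k \notin T & h.2 = edge a k + edge b k - edge omega k.
  move: h1; case: hs => [|k kT|k kT|k kT|||p pT];
    try (by exists k); move=> /= /eq_index;
    rewrite !Lambda_index; discriminate.
case: hE => k kT ->.
have hL := half _ (introT (eigenbasisP _) (EigenHalfL kT)) erefl.
have hR := half _ (introT (eigenbasisP _) (EigenHalfR kT)) erefl.
have [->|->] : g.2 = edge omega a - edge a b \/ g.2 = edge omega b - edge a b.
  move: g1; case: gs => [|h' _|h' _|h' _|||p _];
    try (by left); try (by right); move=> /= /eq_index;
    rewrite !Lambda_index; discriminate.
  by rewrite minus_half_mul_minus_one // dotgNl hR oppr0.
(* Exchanging [a] and [b] reduces this to the previous case, now with the other 1/2-eigenvector. *)
rewrite [edge a b]edgeC [edge a k + _]addrC.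
by rewrite minus_half_mul_minus_one ?Tba // dotgNl hL oppr0.
Qed.

Lemma axis_no_fusion l k n : l \in star_Lambda K -> k \in star_Lambda K ->
  n \in star_Lambda K -> n \notin star_fusion l k -> no_fusion l k n.
Proof.
have neq (u v : K) : index u (star_Lambda K) != index v (star_Lambda K) ->
  u != v by apply: contraNneq => ->.
have supp l' k' n' : (forall i j h : bool, [&& eigen_class l' == j + h,
    eigen_class k' == i + h & eigen_class n' == i + j]%N = false) ->
  no_fusion l' k' n' by move=> ? ? ? ?; apply: fusion_support.
(* Abstracting the predicate stops failed alternatives from unfolding it. *)
move: no_fusion no_fusion_one no_fusion_minus no_fusionC no_fusion_rot supp.
move=> N one minus symC rot supp.
rewrite !inE; do 3 case/or4P=> [/eqP->|/eqP->|/eqP->|/orP[]/eqP->].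
all: rewrite /star_fusion !Lambda_index /star_fusion_table /= => nF.
(* Of the 125 triples, those allowed by the table contradict [nF]. The others are excluded by
   supports, by an eigenvalue 1 in some position, or as a rearrangement of (-1/2, -1, -1). *)
all: first [ by move: nF; rewrite !inE !eqxx ?orbT
  | by apply: supp; rewrite /eigen_class !Lambda_index; do 3!case
  | by apply: one; apply: neq; rewrite !Lambda_index
  | by apply: symC; apply: one; apply: neq; rewrite !Lambda_index
  | by apply: rot; apply: one; apply: neq; rewrite !Lambda_index
  | exact: minus
  | by apply: symC; exact: minus
  | by apply: rot; exact: minus ].
Qed.

Lemma eigenbasis_Lambda l : l \in unzip1 eigenbasis -> l \in star_Lambda K.
Proof.
by case/mapP=> lv /eigenbasisP lvs ->; case: lvs => *;
  rewrite !inE eqxx ?orbT.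
Qed.

Lemma axis_eigenvalue l : leigenvalue L l -> l \in star_Lambda K.
Proof.
move/(eigenbasis_leigenvalue eigenbasis_eigen eigenbasis_span eigenbasis_size).
exact: eigenbasis_Lambda.
Qed.

Lemma axis_fusion_law l k x y : l \in star_Lambda K -> k \in star_Lambda K ->
    x \in leigenspace L l -> y \in leigenspace L k ->
  mul x y \in (\sum_(n <- star_fusion l k) leigenspace L n)%VS.
Proof.
move=> lL kL xl yk.
apply: (mem_sum_leigenspace axis_adjoint eigenbasis_eigen eigenbasis_span).
move=> n z /eigenbasis_Lambda nL nF zn.
exact: axis_no_fusion lL kL nL nF _ _ _ xl yk zn.
Qed.

(** The axis is a multiple of the 1-eigenvector [star_sum a b], so [L] fixes it. *)
Lemma axis_idempotent : mul c c = c.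
Proof.
have Lf : L (star_sum a b) = star_sum a b.
  by rewrite (eigenbasis_eigen (introT (eigenbasisP _) EigenOne)) scale1r.
have : L c = c by rewrite axisE linearZ /= Lf.
by rewrite lfunE.
Qed.

Lemma axis_zero_product x y : m = 5%N ->
  x \in leigenspace L 0 -> y \in leigenspace L 0 -> mul x y = 0.
Proof.
move=> m5 x0 y0; apply/ffunP => r; rewrite [LHS]gmulE ffunE.
have zero v p : v \in leigenspace L 0 -> p \notin remote -> v p = 0.
  move=> v0; rewrite inE => pT; apply: (axis_support v0).
  by rewrite /eigen_class Lambda_index /point_class cards_eq0 setI_eq0.
(* For m = 5 a single point [p0] avoids [T], so the product is a multiple of the square of its basis
   vector, which is 0. *)
have /eqP/cards1P[p0 remE] : #|remote| = 1%N by rewrite card_remote m5.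
rewrite big1 // => p _; rewrite big1 // => q _.
have [|/(zero _ _ x0) xp] := boolP (p \in remote); last by rewrite xp !mul0r.
have [|/(zero _ _ y0) yq] := boolP (q \in remote);
  last by rewrite yq mulr0 !mul0r.
rewrite remE !inE => /eqP-> /eqP->.
rewrite /gcoef big_pred0 ?mulr0 // => t; rewrite /= !inE eqxx /=.
by rewrite !andbF.
Qed.

End Axis.

(** * Generation by the axes *)

Section Generation.

Variables (K : fieldType) (m : nat) (omega : 'I_m).
Hypothesis charK0 : [pchar K] =i pred0.

Local Notation mul := (G2mul K (star_decoration omega)).
Local Notation edge := (edge K).
Local Notation star_sum := (star_sum K omega).

(** The block [{i, j, k}] misses [omega] and contributes [+ edge j k], which cancels the
    [- edge j k] from the product with [edge omega k]. The rest of the product cancels all of the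
    two sums but [edge omega i], counted twice. *)
Lemma star_sum_mul i j k : uniq [:: omega; i; j; k] ->
  star_sum i j + star_sum i k + mul (star_sum i j) (star_sum i k) =
  2%:R *: edge omega i.
Proof.
move=> U; have := U; rewrite /= !inE !negb_or !andbT.
case/and3P=> /and3P[n1 n2 n3] /andP[n4 n5] n6.
have Uij : uniq [:: omega; i; j] by rewrite /= !inE !negb_or n1 n2 n4.
have kT : k \notin [set omega; i; j].
  by rewrite !inE !negb_or ![k == _]eq_sym n3 n5.
rewrite {3}/star_sum !linearDr /= star_sum_mul_omega //.
rewrite star_sum_mul_omega_out // star_sum_mul_base_out // /star_sum.
by apply/ffunP => q; rewrite !ffunE /GRing.scale /=; ring.
Qed.

Lemma star_axes_generate : (5 <= m)%N ->
  generated_by mul (mem (star_axes K omega)).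
Proof.
move=> m5 U sXU mulU.
have Usum i j : uniq [:: omega; i; j] -> star_sum i j \in U.
  move=> Uij; have := Uij; rewrite /= !inE negb_or andbT.
  case/andP=> /andP[n1 n2] n3.
  have cb : #|[set omega; i; j]| == 3%N.
    by rewrite setUC cardsU1 !inE negb_or ![j == _]eq_sym n2 n3 cards2 n1.
  pose t : block m := exist _ [set omega; i; j] cb.
  have : G2idem K (star_decoration omega) t \in U.
    by apply: sXU; apply/imageP; exists t; rewrite // !inE eqxx.
  rewrite (axisE K Uij (blk := t)) // => /(rpredZ (- 2%:R)).
  rewrite scalerA mulrNN mulfV ?scale1r //.
  exact: natr_neq0.
have pick3 (i j : 'I_m) : exists k, k \notin [set omega; i; j].
  apply/existsP; apply: contraLR m5; rewrite negb_exists => /forallP all3.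
  rewrite -ltnNge -[m in (m < _)%N]card_ord -cardsT.
  have /subset_leq_card h : [set: 'I_m] \subset [set omega; i; j].
    by apply/subsetP => x _; have := all3 x; rewrite negbK.
  apply: leq_ltn_trans h _.
  by rewrite cardsU cards1 cards2; case: (_ != _) => /=; lia.
have Uo i : omega != i -> edge omega i \in U.
  (* The repeated argument makes [j] avoid only [omega] and [i]; the next choice avoids [j] as
     well. *)
  move=> ni; have [j] := pick3 i i.
  rewrite !inE !negb_or => /andP[/andP[j1 j2] _].
  have [k] := pick3 i j; rewrite !inE !negb_or => /andP[/andP[k1 k2] k3].
  have Uij : uniq [:: omega; i; j].
    by rewrite /= !inE negb_or ni eq_sym j1 eq_sym j2.
  have Uik : uniq [:: omega; i; k].
    by rewrite /= !inE negb_or ni eq_sym k1 eq_sym k2.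
  have Uijk : uniq [:: omega; i; j; k].
    by rewrite /= !inE !negb_or ni ![_ == j]eq_sym ![_ == k]eq_sym j1 j2 k1 k2 k3.
  have : 2%:R *: edge omega i \in U.
    rewrite -(star_sum_mul Uijk) rpredD ?mulU ?Usum //.
    by rewrite rpredD ?Usum.
  by move/(rpredZ 2%:R^-1); rewrite scalerA mulVf ?scale1r ?(natr_neq0 charK0 1).
apply: evec_generate => p; have [i [j [nij Ep ->]]] := point_edge K p.
have [io|ni] := eqVneq i omega; last have [->|nj] := eqVneq j omega.
- by rewrite io in nij *; apply: Uo.
- by rewrite edgeC; apply: Uo; rewrite eq_sym.
rewrite eq_sym in ni; rewrite eq_sym in nj.
have -> : edge i j = star_sum i j - edge omega i - edge omega j.
  by rewrite /star_sum; apply/ffunP => q; rewrite !ffunE; ring.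
rewrite rpredB ?Uo // rpredB ?Uo // Usum //.
by rewrite /= !inE negb_or ni nj nij.
Qed.

End Generation.

Theorem theorem4p4 (K : fieldType) (charK0 : [pchar K] =i pred0)
    (m : nat) (m_ge5 : (5 <= m)%N) (omega : 'I_m) :
  [/\ is_axial_algebra (G2mul K (star_decoration omega))
        (mem (star_axes K omega)) (star_Lambda K) (@star_fusion K),
      forall b : block m, omega \in supp b ->
        Spec_is
          (Lmul (G2mul K (star_decoration omega))
                (G2idem K (star_decoration omega) b))
          (star_spectrum K m)
    & m = 5%N -> forall b : block m, omega \in supp b ->
      forall x y : galg K (point m),
        x \in leigenspace (Lmul (G2mul K (star_decoration omega))
                                (G2idem K (star_decoration omega) b)) 0 ->
        y \in leigenspace (Lmul (G2mul K (star_decoration omega))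
                                (G2idem K (star_decoration omega) b)) 0 ->
        G2mul K (star_decoration omega) x y = 0].
Proof.
(* Any block through [omega] has support [{omega, i, j}], so the results on a single axis apply to
   it. *)
have suppE (b : block m) : omega \in supp b ->
    exists i j, uniq [:: omega; i; j] /\ supp b = [set omega; i; j].
  move=> ob; have /cards2P[i [j [nij Eij]]] : #|supp b :\ omega| == 2%N.
    have /eqP := cardsD1 omega (supp b).
    by rewrite ob (eqP (valP b)) add1n eqSS eq_sym.
  have [ni nj] : i != omega /\ j != omega.
    have : i \in supp b :\ omega by rewrite Eij !inE eqxx.
    have : j \in supp b :\ omega by rewrite Eij !inE eqxx orbT.
    by rewrite !inE => /andP[-> _] /andP[-> _].
  exists i, j; split; last by rewrite -(setD1K ob) Eij setUA.
  by rewrite /= !inE negb_or ![omega == _]eq_sym ni nj nij.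
have axisP c : c \in mem (star_axes K omega) -> exists b i j,
    [/\ uniq [:: omega; i; j], supp b = [set omega; i; j] &
        c = G2idem K (star_decoration omega) b].
  case/imageP=> b ob ->; have [i [j [U E]]] := suppE b ob.
  by exists b, i, j.
split; last 2 first.
- by move=> b /suppE[i [j [U E]]]; apply: (axis_spectrum charK0 U E).
- move=> m5 b /suppE[i [j [U E]]] x y.
  exact: (axis_zero_product charK0 U E m5).
split.
- exact: G2mulC.
- by move=> _ /axisP[b [i [j [U E ->]]]]; apply: (axis_idempotent charK0 U E).
- exact: star_axes_generate.
- move=> _ /axisP[b [i [j [U E ->]]]]; exact: (axis_diagonalizable charK0 U E).
- move=> _ /axisP[b [i [j [U E ->]]]]; exact: (axis_eigenvalue charK0 U E).
(* The table is checked entry by entry; an index beyond it yields the default empty list. *)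
- move=> l k _ _; apply/allP; rewrite /star_fusion.
  move: (index l _) (index k _) => i j.
  case: i => [|[|[|[|[|i]]]]]; case: j => [|[|[|[|[|j]]]]];
    by rewrite /= ?nth_nil //= !inE !eqxx ?orbT.
- move=> _ /axisP[b [i [j [U E ->]]]] l k lL kL x y xl yk.
  exact: (axis_fusion_law charK0 U E lL kL xl yk).
Qed.
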